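(* Let $m\in\mathbb N$, $a>0$, let $t$ be a nonnegative integer and let $\mathbf r=(r_j)_{j=1}^\infty$ be a sequence of positive reals with $0<r=r_1=\dots=r_{t+1}$ and $r_{t+2}\le r_{t+3}\le\cdots$. Put $\lambda:=\max\{m/a,1/r\}$ and assume that $\lambda r_{t+2}>1$ and $$M(t):=\sum_{j=t+2}^\infty\frac{1}{\lambda r_j-1}\Big(\frac32\Big)^{-(\lambda r_j-1)}<\infty .$$ Then for every $T\ge1$ $$|G(T)|\ \le\ C(a,r,m,t)\begin{cases}T^{m/a},& r>a/m,\\ T^{m/a}\log(2T^{1/a}+1)\,[r^{-1}\log T+(t+1)\log2]^t,& r=a/m,\\ T^{1/r}\,[r^{-1}\log T+(t+1)\log2]^t,& r<a/m,\end{cases}$$ where $C(a,r,m,t):=e^{M(t)}B(a,r,m,t)$.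
   Context: $\mathbb Z_+=\{0,1,2,\dots\}$; $\mathbb Z^\infty_{+*}$ is the set of sequences $\mathbf s=(s_j)_{j\ge1}$ of nonnegative integers with only finitely many nonzero entries. $|\cdot|$ denotes cardinality. The hyperbolic cross is $$G(T):=\Big\{(\mathbf k,\mathbf s)\in\mathbb Z^m_+\times\mathbb Z^\infty_{+*}:\ \max_{1\le j\le m}(1+k_j)^a\prod_{j=1}^{t+1}(1+s_j)^r\prod_{j=t+2}^\infty(1+s_j)^{r_j}\le T\Big\}.$$ The constant $B$ is $$B(a,r,m,t):=\begin{cases}\left(\frac32\right)^m\Big(1+\frac{1}{rm/a-1}\left(\frac32\right)^{-(rm/a-1)}\Big)^{t+1},& r>a/m,\\ m\,\frac{2^{t+1}}{t!},& r=a/m,\\ m\,\frac{2^{t+1}}{t!}\,(a/r-m)^{-1}\,2^{a/r-m},& r<a/m.\end{cases}$$ *)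

(* Defs.v *)
From HB Require Import structures.
From mathcomp Require Import all_boot all_order all_algebra finmap.
From mathcomp Require Import all_classical all_reals all_analysis.

Set Implicit Arguments.
Unset Strict Implicit.
Unset Printing Implicit Defensive.
Import Order.TTheory GRing.Theory Num.Theory.
Local Open Scope classical_set_scope.
Local Open Scope ring_scope.

(* All indices start at 0: the 1-based k_j, s_j, r_j are [k (j-1)], [s (j-1)],
   [rs (j-1)].  So the range 1 <= j <= t+1 becomes j < t.+1, and j >= t+2
   becomes t < j; in particular r_{t+2} is [rs t.+1]. *)

(* [{fsfun nat -> nat with 0}] is the type of finitely supported sequences of
   natural numbers, i.e. Z^infty_{+*}. *)
Definition cross_index (m : nat) : choiceType :=
  ({ffun 'I_m -> nat} * {fsfun nat -> nat with 0%N})%type.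

(* The default value 0 of the maximum is harmless for m > 0, since the terms
   are positive.  The infinite product is a finitely supported one: when
   [rs j != 0], its j-th factor differs from 1 exactly when [s j != 0]. *)
Definition cross_weight (R : realType) (a r : R) (rs : nat -> R) (m t : nat)
    (k : 'I_m -> nat) (s : nat -> nat) : R :=
  \big[Num.max/0]_(j < m) ((1 + (k j)%:R) `^ a)
  * \prod_(j < t.+1) ((1 + (s j)%:R) `^ r)
  * \big[*%R/1]_(j \in [set j : nat | (t < j)%N]) ((1 + (s j)%:R) `^ rs j).

Definition hyperbolic_cross (R : realType) (a r : R) (rs : nat -> R)
    (m t : nat) (T : R) : set (cross_index m) :=
  [set ks : cross_index m | cross_weight a r rs t ks.1 ks.2 <= T].
Arguments hyperbolic_cross {R} a r rs m t T _ : assert.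

Definition lambda (R : realType) (a r : R) (m : nat) : R :=
  Num.max (m%:R / a) r^-1.

(* Extended-real sum, so that finiteness of M(t) is [constM a r rs m t < +oo]. *)
Definition constM (R : realType) (a r : R) (rs : nat -> R) (m t : nat) : \bar R :=
  (\sum_(t.+1 <= j <oo)
     ((lambda a r m * rs j - 1)^-1
      * (3 / 2) `^ (- (lambda a r m * rs j - 1)))%:E)%E.

Definition constB (R : realType) (a r : R) (m t : nat) : R :=
  if a / m%:R < r then
    (3 / 2) ^+ m
    * (1 + (r * m%:R / a - 1)^-1 * (3 / 2) `^ (- (r * m%:R / a - 1))) ^+ t.+1
  else if r == a / m%:R then
    m%:R * (2 ^+ t.+1 / t`!%:R)
  else
    m%:R * (2 ^+ t.+1 / t`!%:R) * (a / r - m%:R)^-1 * 2 `^ (a / r - m%:R).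

Definition constC (R : realType) (a r : R) (rs : nat -> R) (m t : nat) : R :=
  expR (fine (constM a r rs m t)) * constB a r m t.

(* Main.v *)
Require Import Defs.
From HB Require Import structures.
From mathcomp Require Import all_boot all_order all_algebra finmap.
From mathcomp Require Import all_classical all_reals all_analysis.
From mathcomp Require Import ring lra.

Import Order.TTheory GRing.Theory Num.Theory.
Local Open Scope classical_set_scope.
Local Open Scope ring_scope.

(** Write w(k, s) for the weight of an index, split as K W P: the maximum K of
    the (1 + k_j)^a, the product W over the t + 1 head coordinates of s, where
    all exponents equal r, and the product P over the tail coordinates.

    For a fixed tail, the admissible (k, head) are those with K W <= T / P.  The
    whole proof rests on bounding this head count by B (T / P)^lambda times a
    logarithmic factor which is monotone in its argument, hence can be taken at
    T ([head_count_le]).  What is then left is T^lambda times the sum over all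
    tails of P^(-lambda), and that sum factorizes into sums of
    (1 + i)^(- lambda r_j), each at most 1 + M_j with M_j the j-th term of
    M(t); the product of the 1 + M_j is at most e^M(t)
    ([cross_count_le], [prod_1D_le_expR]).

    The head count depends on which of k and s dominates.

    - If r > a/m, fix s first.  The k with K <= Y form a cube with at most
      Y^(m/a) points, and the sum over s of W^(-m/a) converges
      ([head_count_gt]).
    - If r = a/m, fix s first as well.  Now W^(-m/a) is the reciprocal of the
      product of the 1 + s_j, and the reciprocals have to be summed over the
      points below a hyperbola; the sum is a power of a logarithm
      ([head_count_eq], [sum_inv_vol_le]).
    - If r < a/m, fix k first.  The s allowed form a hyperbolic cross in
      dimension t + 1, and the resulting negative power of K is summable over k,
      because few k have a given maximum ([head_count_lt], [count_vol_le],
      [sum_kmax_powRN_le]).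

    Two one-variable comparisons with integrals enter, both in telescoping
    form: (1 + i)^(-p) against its integral over a unit interval centred at
    1 + i, which explains the constants 3/2 and 2 in B ([powRN_midpoint]), and
    1 / (1 + i) against twice the increment of a logarithm, which explains the
    factors 2^(t+1) and the shifts by (t + 1) log 2 ([sum_inv_vol_le]).

    All counts are made over finite boxes of side N with bounds free of N.  Any
    finite part of G(T) lies in such a box, so the cardinalities of the finite
    parts of G(T) are uniformly bounded; this yields finiteness and the bound at
    once ([card_sub_cross_le]). *)

(** * Midpoint estimate for negative powers *)

Lemma powRD_gt0 (R : realType) (x p q : R) :
  0 < x -> x `^ (p + q) = x `^ p * x `^ q.
Proof. by move=> x0; apply: powRD; rewrite (gt_eqF x0) implybT. Qed.

Lemma powRN_le (R : realType) (x y p : R) :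
  0 < x -> x <= y -> 0 <= p -> y `^ (- p) <= x `^ (- p).
Proof.
move=> x0 xy p0; have y0 := lt_le_trans x0 xy.
rewrite !powRN lef_pV2 ?posrE ?powR_gt0 //.
by apply: ge0_ler_powR => //; rewrite nnegrE ltW.
Qed.

(** Arithmetic-geometric mean inequality, then (k - h)(k + h) <= k^2. *)
Lemma midpoint_convexity_powRN (R : realType) (k h p : R) :
  0 <= h -> h < k -> 0 <= p ->
  2 * k `^ (- p) <= (k - h) `^ (- p) + (k + h) `^ (- p).
Proof.
move=> h0 hk p0.
have x0 : 0 < k - h by lra.
have y0 : 0 < k + h by lra.
set q := p / 2; have pE : - p = - q + - q by rewrite /q; lra.
have sq (z : R) : 0 < z -> z `^ (- p) = z `^ (- q) * z `^ (- q).
  by move=> z0; rewrite pE powRD_gt0.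
have k0 : 0 < k by lra.
rewrite (sq k) // (sq (k - h)) // (sq (k + h)) // -powRM ?(ltW k0) //.
set u := (k - h) `^ _; set v := (k + h) `^ _.
have le_uv : (k * k) `^ (- q) <= u * v.
  rewrite /u /v -powRM ?(ltW x0) ?(ltW y0) //.
  apply: powRN_le; [exact: mulr_gt0 | nra | exact: divr_ge0].
by have := sqr_ge0 (u - v); nra.
Qed.

(** The right-hand side is the integral of x^(-q-1) over the unit interval
    centred at k, so this is the midpoint rule for a convex function.  The
    integral is avoided by letting the half-width h grow from 0 to 1/2: the
    derivative in h of the difference of the two sides is nonnegative by
    midpoint convexity. *)
Lemma powRN_midpoint (R : realType) (k q : R) : 1 / 2 < k -> 0 < q ->
  k `^ (- (q + 1)) <= q^-1 * ((k - 1 / 2) `^ (- q) - (k + 1 / 2) `^ (- q)).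
Proof.
move=> k12 q0; rewrite mulrC ler_pdivlMr //.
pose g (h : R) := (k - h) `^ (- q) - (k + h) `^ (- q)
                  - h * (2 * q * k `^ (- (q + 1))).
pose dg (h : R) := q * ((k - h) `^ (- (q + 1)) + (k + h) `^ (- (q + 1))
                  - 2 * k `^ (- (q + 1))).
have qE : - q - 1 = - (q + 1) by lra.
have dgP (h : R) : 0 <= h <= 1 / 2 -> is_derive h 1 g (dg h).
  move=> /andP[h0 h1].
  have x0 : 0 < k - h by lra.
  have y0 : 0 < k + h by lra.
  have dl : is_derive h 1 (fun h => k - h) (-1 : R).
    apply: is_derive_eq. ring.
  have dr : is_derive h 1 (fun h => k + h) (1 : R).
    apply: is_derive_eq; ring.
  have dx := @is_derive1_comp _ ((@powR R)^~ (- q)) (fun h => k - h) h _ _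
    (is_derive1_powR (- q) x0) dl.
  have dy := @is_derive1_comp _ ((@powR R)^~ (- q)) (fun h => k + h) h _ _
    (is_derive1_powR (- q) y0) dr.
  have dz : is_derive h 1 (fun h => h * (2 * q * k `^ (- (q + 1))))
     (2 * q * k `^ (- (q + 1))).
    apply: is_derive_eq; rewrite /GRing.scale /=; ring.
  have dxyz : is_derive h 1 g _ := is_deriveB (is_deriveB dx dy) dz.
  apply: is_derive_eq; rewrite qE /dg; ring.
have : g 0 <= g (1 / 2).
  apply: (@ger0_derive1_ndecr _ g 0 (1 / 2)) => //.
  - move=> x; rewrite in_itv /= => /andP[x0 x1].
    by have [] : is_derive x 1 g (dg x) by apply: dgP; rewrite !ltW.
  - move=> x; rewrite in_itv /= => /andP[x0 x1].
    have [_ ] : is_derive x 1 g (dg x) by apply: dgP; rewrite !ltW.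
    rewrite derive1E => ->; apply: mulr_ge0; first exact: ltW.
    rewrite subr_ge0; apply: midpoint_convexity_powRN; lra.
  - apply: derivable_within_continuous => x; rewrite in_itv /= => x01.
    by have [] := dgP _ x01.
rewrite /g subr0 addr0 subrr mul0r subr0; lra.
Qed.

(** * Partial sums of zeta series *)

Lemma sum_powRN_le (R : realType) (q : R) (n N : nat) : 0 < q -> (0 < n)%N ->
  \sum_(n <= i < N) i%:R `^ (- (q + 1)) <= q^-1 * (n%:R - 1 / 2) `^ (- q).
Proof.
move=> q0 n0; have [Nn|nN] := leqP N n.
  by rewrite big_geq // mulr_ge0 ?powR_ge0 // invr_ge0 ltW.
pose f (i : nat) : R := - (q^-1 * (i%:R - 1 / 2) `^ (- q)).
apply: (@le_trans _ _ (\sum_(n <= i < N) (f i.+1 - f i))).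
  rewrite big_nat [leRHS]big_nat; apply: ler_sum => i /andP[ni _].
  have i1 : 1 <= i%:R :> R by rewrite ler1n (leq_trans n0).
  apply: le_trans (@powRN_midpoint _ i%:R q _ q0) _; first by lra.
  rewrite /f -(natr1 i) (_ : i%:R + 1 - 1 / 2 = i%:R + 1 / 2); last by lra.
  by rewrite opprK mulrBr addrC.
rewrite telescope_sumr ?(ltnW nN) // /f opprK addrC gerDl oppr_le0.
by rewrite mulr_ge0 ?powR_ge0 // invr_ge0 ltW.
Qed.

(** All terms are compared with integrals, so the integration starts at 1/2. *)
Lemma zeta_sum_le_2 (R : realType) (q : R) (N : nat) : 0 < q ->
  \sum_(i < N) (1 + i%:R) `^ (- (q + 1)) <= q^-1 * 2 `^ q.
Proof.
move=> q0; have := @sum_powRN_le _ q 1 N.+1 q0 isT.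
rewrite big_add1 big_mkord /= (_ : 1 - 1 / 2 = 2^-1); last by lra.
rewrite -[2^-1]powR_inv1 // -powRrM mulN1r opprK; apply: le_trans.
by under eq_bigr do rewrite nat1r.
Qed.

(** The first term is kept exact, so the integration starts at 3/2. *)
Lemma zeta_sum_le_32 (R : realType) (p : R) (N : nat) : 1 < p ->
  \sum_(i < N) (1 + i%:R) `^ (- p) <=
  1 + (p - 1)^-1 * (3 / 2) `^ (- (p - 1)).
Proof.
move=> p1; have q0 : 0 < p - 1 by lra.
case: N => [|N].
  rewrite big_ord0 addr_ge0 // mulr_ge0 ?powR_ge0 // invr_ge0 ltW //.
rewrite big_ord_recl addr0 powR1 lerD2l.
have := @sum_powRN_le _ (p - 1) 2 N.+2 q0 isT.
rewrite (_ : 2%:R - 1 / 2 = 3 / 2); last by lra.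
apply: le_trans; rewrite 2!big_add1 big_mkord /= subrK.
by under eq_bigr do rewrite nat1r.
Qed.

(** * Sums over boxes *)

Lemma powR_prod (R : realType) (I : Type) (s : seq I) (P : pred I)
    (F : I -> R) (x : R) : (forall i, 0 <= F i) ->
  (\prod_(i <- s | P i) F i) `^ x = \prod_(i <- s | P i) F i `^ x.
Proof.
move=> F0; elim: s => [|i s IH]; first by rewrite !big_nil powR1.
by rewrite !big_cons; case: (P i); rewrite // powRM ?IH // prodr_ge0.
Qed.

Lemma powR_le_powRV (R : realType) (a x y : R) : 0 < a -> 0 <= x -> 0 <= y ->
  (x `^ a <= y) = (x <= y `^ a^-1).
Proof.
move=> a0 x0 y0; have a0' : a != 0 by rewrite gt_eqF.
apply/idP/idP => [xy|xy].
  have := @ge0_ler_powR _ a^-1 _ (x `^ a) y; rewrite !nnegrE powR_ge0.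
  by rewrite -powRrM mulfV // powRr1 //; apply; rewrite // invr_ge0 ltW.
have := @ge0_ler_powR _ a (ltW a0) x (y `^ a^-1); rewrite !nnegrE powR_ge0.
by rewrite -powRrM mulVf // powRr1 //; apply.
Qed.

Lemma natr_forall (R : realType) (I : finType) (P : pred I) :
  ([forall i, P i])%:R = \prod_i (P i)%:R :> R.
Proof.
case: forallP => [PI|/forallP]; first by rewrite big1 // => i _; rewrite PI.
rewrite negb_forall => /existsP[i nPi].
by rewrite (bigD1 i) //= (negbTE nPi) mul0r.
Qed.

Lemma count_posint_le (R : realType) (N : nat) (Y : R) : 0 <= Y ->
  \sum_(i < N) (1 + i%:R <= Y)%R%:R <= Y.
Proof.
move=> Y0; elim: N => [|N IH]; first by rewrite big_ord0.
have [NY|NY] := boolP (1 + N%:R <= Y).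
  apply: le_trans NY; rewrite nat1r.
  apply: (@le_trans _ _ (\sum_(i < N.+1) 1)); last first.
    by rewrite sumr_const card_ord.
  by apply: ler_sum => i _; rewrite lern1 leq_b1.
by rewrite big_ord_recr /= (negbTE NY) addr0.
Qed.

Lemma count_cube (R : realType) (m N : nat) (Y : R) : 0 <= Y ->
  \sum_(k : {ffun 'I_m -> 'I_N}) [forall j, (1 + (k j)%:R <= Y)%R]%:R <= Y ^+ m.
Proof.
move=> Y0; under eq_bigr do rewrite natr_forall.
rewrite -(bigA_distr_bigA (fun (_ : 'I_m) (i : 'I_N) => (1 + i%:R <= Y)%R%:R)).
rewrite prodr_const card_ord lerXn2r // ?nnegrE ?count_posint_le //.
exact: sumr_ge0.
Qed.

(** A sum over a box of a product of one-variable functions is the product of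
    the one-variable sums. *)
Lemma sum_prod_powR_le (R : realType) (n N : nat) (l : R) (rho : nat -> R) :
  (forall j, (j < n)%N -> 1 < l * rho j) ->
  \sum_(s : {ffun 'I_n -> 'I_N})
     (\prod_(j < n) (1 + (s j)%:R) `^ rho j) `^ (- l) <=
  \prod_(j < n) (1 + (l * rho j - 1)^-1 * (3 / 2) `^ (- (l * rho j - 1))).
Proof.
move=> rho1; under eq_bigr => s _.
  rewrite powR_prod; last by move=> i; exact: powR_ge0.
  over.
rewrite -(bigA_distr_bigA
  (fun (j : 'I_n) (i : 'I_N) => ((1 + i%:R) `^ rho j) `^ (- l))).
apply: ler_prod => j _; apply/andP; split.
  by apply: sumr_ge0 => i _; exact: powR_ge0.
under eq_bigr do rewrite -powRrM mulrN mulrC.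
by apply: zeta_sum_le_32; exact: rho1.
Qed.

(** The coordinate j that attains the maximum v can be chosen in m ways, and
    each of the others then lies in [0, v].  A tie counts once per maximal
    coordinate, so the left-hand side dominates the sum of f at the maximum. *)
Lemma sum_max_coord_le (R : realType) (m N : nat) (f : nat -> R) :
  (forall v, 0 <= f v) ->
  \sum_(k : {ffun 'I_m -> 'I_N})
     \sum_(j < m) [forall i, (k i <= k j)%N]%:R * f (k j) <=
  m%:R * \sum_(v < N) v.+1%:R ^+ m.-1 * f v.
Proof.
move=> f0; rewrite exchange_big /= mulr_natl.
rewrite -[X in _ <= _ *+ X]card_ord -sumr_const; apply: ler_sum => j _.
have -> : \sum_(k : {ffun 'I_m -> 'I_N}) [forall i, (k i <= k j)%N]%:R * f (k j)
  = \sum_(k : {ffun 'I_m -> 'I_N}) \sum_(v < N)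
      (\prod_i (if i == j then k i == v else (k i <= v)%N)%:R) * f v.
  apply: eq_bigr => k _; rewrite (bigD1 (k j)) //= [X in _ + X]big1 ?addr0.
    congr (_ * _); rewrite natr_forall; apply: eq_bigr => i _.
    by case: eqVneq => [->|//]; rewrite leqnn eqxx.
  move=> v vk; rewrite (bigD1 j) //= eqxx.
  by rewrite [k j == v]eq_sym (negbTE vk) !mul0r.
rewrite exchange_big; apply: ler_sum => v _ /=; rewrite -big_distrl /=.
apply: ler_wpM2r => //.
rewrite -(bigA_distr_bigA (fun (i : 'I_m) (x : 'I_N) =>
  (if i == j then x == v else (x <= v)%N)%:R)).
rewrite (bigD1 j) //= eqxx (bigD1 v) //= eqxx big1 ?addr0 ?mul1r; last first.
  by move=> i /negbTE ->.
apply: (@le_trans _ _ (\prod_(i | i != j) v.+1%:R)); last first.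
  by rewrite prodr_const cardC1 card_ord.
apply: ler_prod => i /negbTE ->; apply/andP; split; first exact: sumr_ge0.
apply: le_trans (@count_posint_le _ N v.+1%:R _) => //.
apply: ler_sum => x _.
by have -> : (1 + x%:R <= v.+1%:R :> R) = (x <= v)%N by rewrite nat1r ler_nat.
Qed.

(** * Sums and counts below a hyperbola *)

Definition ffun_cons (J : finType) (n : nat) (x : J) (g : {ffun 'I_n -> J}) :
    {ffun 'I_n.+1 -> J} :=
  [ffun i => if unlift ord0 i is Some j then g j else x].

Lemma sum_ffun_cons (R : realType) (J : finType) (n : nat)
    (F : {ffun 'I_n.+1 -> J} -> R) :
  \sum_(f : {ffun 'I_n.+1 -> J}) F f =
  \sum_(x : J) \sum_(g : {ffun 'I_n -> J}) F (ffun_cons J n x g).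
Proof.
rewrite pair_big /= (reindex (fun p => ffun_cons J n p.1 p.2)) //=.
exists (fun f => (f ord0, [ffun i => f (lift ord0 i)])) => [[x g]|f] _ /=.
  congr (_, _); first by rewrite ffunE unlift_none.
  by apply/ffunP => i; rewrite !ffunE liftK.
apply/ffunP => i; rewrite ffunE; case: unliftP => [j ->|->] //.
by rewrite ffunE.
Qed.

(** Number of lattice points of the box [0, s]. *)
Definition vol (R : realType) (n : nat) (s : 'I_n -> nat) : R :=
  \prod_(j < n) (1 + (s j)%:R).

Lemma vol_ge1 (R : realType) (n : nat) (s : 'I_n -> nat) : 1 <= vol R n s.
Proof.
rewrite /vol; elim/big_ind: _ => [|x y|j _] //.
  exact: mulr_ege1.
by rewrite lerDl.
Qed.

Lemma vol_gt0 (R : realType) (n : nat) (s : 'I_n -> nat) : 0 < vol R n s.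
Proof. exact: lt_le_trans (vol_ge1 _ _ _). Qed.

Lemma vol_ffun_cons (R : realType) (n N : nat) (x : 'I_N)
    (g : {ffun 'I_n -> 'I_N}) :
  vol R n.+1 (fun j => ffun_cons _ n x g j) =
  (1 + x%:R) * vol R n (fun j => g j).
Proof.
rewrite /vol big_ord_recl ffunE unlift_none; congr (_ * _).
by apply: eq_bigr => i _; rewrite ffunE liftK.
Qed.

Lemma ln_succ_le (R : realType) (x : nat) :
  ln x.+2%:R <= ln 2 + ln x.+1%:R :> R.
Proof.
have x1 : 0 < x.+1%:R :> R by rewrite ltr0n.
rewrite -lnM ?posrE // ler_ln ?posrE ?ltr0n ?mulr_gt0 //.
by rewrite -natrM ler_nat mul2n -addnn addnS ltnS leq_addr.
Qed.

(** 1 / (x+2) is the minimum of 1 / z on [x+1, x+2]. *)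
Lemma inv_le_ln_succ (R : realType) (x : nat) :
  x.+2%:R^-1 <= ln x.+2%:R - ln x.+1%:R :> R.
Proof.
have x20 : 0 < x.+2%:R :> R by rewrite ltr0n.
have /le_ln1Dx : -1 < - x.+2%:R^-1 :> R.
  by rewrite ltrN2 invf_lt1 // ltr1n.
rewrite (_ : 1 - x.+2%:R^-1 = x.+1%:R / x.+2%:R); last first.
  have -> : x.+1%:R = x.+2%:R - 1 :> R by rewrite -[x.+2%:R]natr1 addrK.
  by rewrite mulrBl mul1r divff // gt_eqF.
by rewrite ln_div ?posrE ?ltr0n // lerNr opprB.
Qed.

(** Discrete substitute for integrating (n+1) z^n between v and u. *)
Lemma exprS_sub_ge (R : realType) (n : nat) (u v : R) : 0 <= v -> v <= u ->
  n.+1%:R * v ^+ n * (u - v) <= u ^+ n.+1 - v ^+ n.+1.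
Proof.
move=> v0 vu; rewrite subrXX mulrC ler_wpM2l ?subr_ge0 //.
apply: (@le_trans _ _ (\sum_(i < n.+1) v ^+ n)).
  by rewrite sumr_const card_ord mulr_natl.
apply: ler_sum => i _; rewrite /= -{1}(subnK (ltn_ord i : (i <= n)%N)) exprD.
by rewrite ler_wpM2r ?exprn_ge0 // lerXn2r // nnegrE ?(le_trans v0).
Qed.

(** By induction on the dimension: with x the first coordinate and
    D = ln Y + (n + 1) ln 2, the induction hypothesis at Y / (1 + x) leaves the
    sum over x of (D - ln 2 - ln (1 + x))^n / (1 + x).  Replacing 1 / (1 + x) by
    2 / (2 + x) and ln 2 + ln (1 + x) by the smaller ln (2 + x) turns the sum
    into a lower Riemann sum of the decreasing function (D - ln z)^n / z, whose
    primitive is - (D - ln z)^(n+1) / (n + 1). *)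
Lemma sum_inv_vol_le (R : realType) (N n : nat) (Y : R) : 1 <= Y ->
  \sum_(s : {ffun 'I_n -> 'I_N})
     (vol R n (fun j => s j) <= Y)%R%:R / vol R n (fun j => s j) <=
  2 ^+ n * (ln Y + n%:R * ln 2) ^+ n / n`!%:R.
Proof.
elim: n Y => [|n IH] Y Y1.
  rewrite expr0 !mul1r fact0 invr1.
  rewrite (eq_bigr (fun=> 1)) => [|s _]; last first.
    by rewrite /vol big_ord0 Y1 divr1.
  by rewrite sumr_const card_ffun !card_ord expn0.
have Y0 : 0 < Y by lra.
pose D : R := ln Y + n.+1%:R * ln 2; rewrite -[ln Y + _]/D.
have ln2 : 0 <= ln 2 :> R by apply: ln_ge0; lra.
(* A telescoping potential; the truncation at 0 keeps it monotone beyond the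
   range where x.+1 <= Y, in which the terms vanish. *)
pose g (x : nat) := Num.max 0 (D - ln x.+1%:R) ^+ n.+1.
have c0 : 0 <= 2 ^+ n.+1 / n.+1`!%:R :> R by rewrite divr_ge0 // exprn_ge0.
have step (x : nat) : (x.+1%:R <= Y)%R%:R / x.+1%:R *
    (2 ^+ n * (ln (Y / x.+1%:R) + n%:R * ln 2) ^+ n / n`!%:R) <=
    2 ^+ n.+1 / n.+1`!%:R * (g x - g x.+1).
  have x1 : 0 < x.+1%:R :> R by rewrite ltr0n.
  have lnx : ln x.+1%:R <= ln x.+2%:R :> R.
    by rewrite ler_ln ?posrE ?ltr0n // ler_nat.
  case: (leP x.+1%:R Y) => [xY|_]; last first.
    rewrite !mul0r mulr_ge0 // subr_ge0 /g.
    have g0 z : 0 <= Num.max 0 z :> R by rewrite le_max lexx.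
    apply: lerXn2r; rewrite ?nnegrE ?g0 // ge_max g0 /= le_max.
    by rewrite lerD2l lerN2 lnx orbT.
  have lnxY : ln x.+1%:R <= ln Y by rewrite ler_ln ?posrE.
  have lns := @ln_succ_le R x; have lni := @inv_le_ln_succ R x.
  have DE : D = ln Y + n%:R * ln 2 + ln 2 by rewrite /D -natr1; ring.
  have n0 : 0 <= n%:R * ln 2 :> R by exact: mulr_ge0.
  have v0 : (0 : R) <= D - ln x.+2%:R by rewrite DE; lra.
  rewrite /g !max_r //; last by lra.
  rewrite ln_div ?posrE //.
  apply: le_trans (_ : _ <= 2 ^+ n.+1 / n.+1`!%:R *
     (n.+1%:R * (D - ln x.+2%:R) ^+ n *
      (ln x.+2%:R - ln x.+1%:R))) _; last first.
    apply: ler_wpM2l => //.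
    apply: le_trans (exprS_sub_ge _ n (D - ln x.+1%:R) (D - ln x.+2%:R) v0 _).
      by apply: ler_wpM2l; [rewrite mulr_ge0 // exprn_ge0 | lra].
    lra.
  have wv : ln Y - ln x.+1%:R + n%:R * ln 2 <= D - ln x.+2%:R.
    by rewrite DE; lra.
  have w0 : 0 <= ln Y - ln x.+1%:R + n%:R * ln 2 by lra.
  set w := ln Y - _ + _; set v := D - _.
  have wvn : w ^+ n <= v ^+ n by rewrite lerXn2r // nnegrE.
  (* This step costs one of the factors 2 of the bound. *)
  have inv2 : x.+1%:R^-1 <= 2 * (ln x.+2%:R - ln x.+1%:R) :> R.
    apply: le_trans (_ : _ <= 2 * x.+2%:R^-1) _; last by rewrite ler_pM2l.
    rewrite ler_pdivlMr ?ltr0n // mulrC ler_pdivrMr ?ltr0n //.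
    by rewrite -natrM ler_nat mul2n -addnn addnS ltnS leq_addr.
  have n1 : n.+1%:R != 0 :> R by rewrite pnatr_eq0.
  rewrite factS natrM invfM exprS.
  have -> : 2 * 2 ^+ n * (n.+1%:R^-1 * n`!%:R^-1) *
       (n.+1%:R * v ^+ n * (ln x.+2%:R - ln x.+1%:R)) =
       2 * (ln x.+2%:R - ln x.+1%:R) * (2 ^+ n * v ^+ n / n`!%:R).
    by rewrite -[RHS]mulr1 -[X in _ = _ * X](mulVf n1); ring.
  rewrite mulr1n mul1r; apply: ler_pM.
  - by rewrite invr_ge0.
  - by rewrite divr_ge0 // mulr_ge0 ?exprn_ge0.
  - exact: inv2.
  - by rewrite ler_wpM2r ?invr_ge0 // ler_wpM2l // exprn_ge0.
rewrite sum_ffun_cons.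
apply: (@le_trans _ _ (\sum_(x < N) 2 ^+ n.+1 / n.+1`!%:R * (g x - g x.+1))).
  apply: ler_sum => x _; apply: le_trans (step x).
  have x1 : 0 < x.+1%:R :> R by rewrite ltr0n.
  have volE (h : {ffun 'I_n -> 'I_N}) :
      (vol R n.+1 (fun j => ffun_cons _ n x h j) <= Y)%R%:R /
      vol R n.+1 (fun j => ffun_cons _ n x h j) =
      x.+1%:R^-1 * ((vol R n (fun j => h j) <= Y / x.+1%:R)%R%:R /
                    vol R n (fun j => h j)).
    by rewrite vol_ffun_cons nat1r invfM mulrCA ler_pdivlMr //
      [x.+1%:R * _]mulrC.
  under eq_bigr do rewrite volE.
  rewrite -mulr_sumr; case: (leP x.+1%:R Y) => [xY|Yx].
    rewrite mulr1n mul1r ler_wpM2l ?invr_ge0 ?(ltW x1) // IH //.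
    by rewrite ler_pdivlMr // mul1r.
  rewrite !mul0r big1 ?mulr0 // => h _.
  rewrite leNgt (lt_le_trans _ (vol_ge1 _ _ _)) ?mul0r //.
  by rewrite ltr_pdivrMr // mul1r.
rewrite -mulr_sumr -[leRHS]mulrAC; apply: ler_wpM2l => //.
rewrite -(big_mkord xpredT (fun x => g x - g x.+1)).
under eq_bigr do rewrite -opprB.
rewrite sumrN telescope_sumr // opprB /g ln1 subr0.
have D0 : 0 <= D by rewrite addr_ge0 ?ln_ge0 // mulr_ge0.
by rewrite (max_r D0) gerBl exprn_ge0 // le_max lexx.
Qed.

(** Once the other n coordinates are fixed, the last one has at most
    Y / vol choices, so the count reduces to the sum of reciprocals in one
    dimension less. *)
Lemma count_vol_le (R : realType) (N n : nat) (Y : R) : 1 <= Y ->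
  \sum_(s : {ffun 'I_n.+1 -> 'I_N}) (vol R n.+1 (fun j => s j) <= Y)%R%:R <=
  Y * (2 ^+ n * (ln Y + n%:R * ln 2) ^+ n / n`!%:R).
Proof.
move=> Y1; rewrite sum_ffun_cons exchange_big /=.
apply: le_trans (ler_wpM2l _ (sum_inv_vol_le R N n Y Y1)); last by lra.
rewrite mulr_sumr; apply: ler_sum => g _; have g0 := vol_gt0 R n (fun j => g j).
case: (leP (vol R n (fun j => g j)) Y) => [gY|Yg].
  rewrite mulr1n mul1r.
  apply: le_trans (count_posint_le R N (Y / vol R n (fun j => g j)) _).
    by apply: ler_sum => x _; rewrite vol_ffun_cons ler_pdivlMr.
  by rewrite divr_ge0 //; lra.
rewrite mul0r mulr0 big1 // => x _; rewrite vol_ffun_cons leNgt.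
rewrite (lt_le_trans Yg) // ler_peMl ?(ltW g0) // lerDl.
by rewrite ler0n.
Qed.

(** * The maximum of the coordinates *)

Lemma powR_ge1 (R : realType) (x p : R) : 1 <= x -> 0 <= p -> 1 <= x `^ p.
Proof. by move=> x1 p0; rewrite -(powRr0 x); exact: ler_powR. Qed.

Definition kmax (R : realType) (a : R) (m : nat) (k : 'I_m -> nat) : R :=
  \big[Num.max/0]_(j < m) (1 + (k j)%:R) `^ a.

(** The sublevel sets of [kmax] are cubes. *)
Lemma kmax_le (R : realType) (a : R) (m : nat) (k : 'I_m -> nat) (Y : R) :
  0 < a -> 0 <= Y ->
  (kmax R a m k <= Y) = [forall j, (1 + (k j)%:R <= Y `^ a^-1)%R].
Proof.
move=> a0 Y0; apply/bigmax_leP/forallP => [[_ kY] j|kY].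
  by rewrite -powR_le_powRV ?addr_ge0 //; exact: kY.
by split=> // j _; rewrite powR_le_powRV ?addr_ge0 //; exact: kY.
Qed.

Lemma kmax_attained (R : realType) (a : R) (m : nat) (k : 'I_m -> nat) :
  0 < a -> (0 < m)%N ->
  exists2 j, kmax R a m k = (1 + (k j)%:R) `^ a & forall i, (k i <= k j)%N.
Proof.
move=> a0 m0; case: (@arg_maxnP _ (Ordinal m0) xpredT k isT) => j _ kj.
exists j => [|i]; last exact: kj.
apply/le_anti/andP; split; last exact: le_bigmax.
apply/bigmax_leP; split => [|i _]; first exact: powR_ge0.
apply: ge0_ler_powR; rewrite ?nnegrE ?(ltW a0) ?addr_ge0 //.
by rewrite lerD2l ler_nat; exact: kj.
Qed.

Lemma kmax_ge1 (R : realType) (a : R) (m : nat) (k : 'I_m -> nat) :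
  0 < a -> (0 < m)%N -> 1 <= kmax R a m k.
Proof.
move=> a0 m0; have [j -> _] := kmax_attained R a m k a0 m0.
by apply: powR_ge1; rewrite ?lerDl // ltW.
Qed.

Lemma count_kmax_le (R : realType) (a : R) (m N : nat) (Y : R) :
  0 < a -> 0 <= Y ->
  \sum_(k : {ffun 'I_m -> 'I_N}) (kmax R a m (fun j => k j) <= Y)%R%:R
    <= Y `^ (m%:R / a).
Proof.
move=> a0 Y0; under eq_bigr do rewrite kmax_le //.
rewrite mulrC powRrM powR_mulrn ?powR_ge0 //.
exact: (count_cube R m N (Y `^ a^-1) (powR_ge0 _ _)).
Qed.

(** About m v^(m-1) of the k have maximum v, so the sum behaves like the one
    of v^(m - 1 - a c), which converges as a c > m. *)
Lemma sum_kmax_powRN_le (R : realType) (a c : R) (m N : nat) :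
  0 < a -> (0 < m)%N -> m%:R < a * c ->
  \sum_(k : {ffun 'I_m -> 'I_N}) kmax R a m (fun j => k j) `^ (- c) <=
  m%:R * ((a * c - m%:R)^-1 * 2 `^ (a * c - m%:R)).
Proof.
move=> a0 m0 mac; have q0 : 0 < a * c - m%:R by rewrite subr_gt0.
(* f v is the summand at a k whose largest coordinate is v. *)
pose f (v : nat) : R := (1 + v%:R) `^ (- (a * c)).
have f0 v : 0 <= f v by exact: powR_ge0.
apply: le_trans (_ : _ <= \sum_(k : {ffun 'I_m -> 'I_N})
     \sum_(j < m) [forall i, (k i <= k j)%N]%:R * f (k j)) _.
  apply: ler_sum => k _.
  have [j -> kj] := kmax_attained R a m (fun j => k j) a0 m0.
  rewrite (bigD1 j) //= (introT forallP kj) mul1r -powRrM mulrN lerDl.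
  by apply: sumr_ge0 => i _; rewrite mulr_ge0.
apply: le_trans (sum_max_coord_le R m N f f0) _; rewrite ler_wpM2l //.
apply: le_trans (zeta_sum_le_2 R _ N q0); rewrite le_eqVlt; apply/orP; left.
apply/eqP; apply: eq_bigr => v _; rewrite /f -nat1r -powR_mulrn //.
have v1 : 0 < 1 + v%:R :> R by rewrite nat1r ltr0n.
rewrite -powRD_gt0 //; congr (_ `^ _).
have -> : m%:R = m.-1%:R + 1 :> R by rewrite natr1 prednK.
by ring.
Qed.

(** * The head count in the three cases *)

Definition head_count (R : realType) (a r : R) (m n N : nat) (T : R) : R :=
  \sum_(k : {ffun 'I_m -> 'I_N}) \sum_(s : {ffun 'I_n -> 'I_N})
    (kmax R a m (fun j => k j) * \prod_(j < n) (1 + (s j)%:R) `^ r <= T)%R%:R.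

Lemma prod_powR_vol (R : realType) (r : R) (n : nat) (s : 'I_n -> nat) :
  \prod_(j < n) (1 + (s j)%:R) `^ r = vol R n s `^ r.
Proof. by rewrite /vol powR_prod // => j; rewrite addr_ge0. Qed.

(** Both factors of the weight are at least 1.  This disposes of the range
    where the logarithms below would be negative. *)
Lemma head_count_lt1 (R : realType) (a r : R) (m n N : nat) (T : R) :
  0 < a -> 0 < r -> (0 < m)%N -> T < 1 -> head_count R a r m n N T = 0.
Proof.
move=> a0 r0 m0 T1; rewrite /head_count big1 // => k _; rewrite big1 // => s _.
rewrite leNgt (lt_le_trans T1) // mulr_ege1 ?kmax_ge1 // prod_powR_vol.
by apply: powR_ge1; rewrite ?vol_ge1 // ltW.
Qed.

Lemma head_count_gt (R : realType) (a r : R) (m n N : nat) (T : R) :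
  0 < a -> (0 < m)%N -> 0 < T -> a / m%:R < r ->
  head_count R a r m n N T <= T `^ (m%:R / a) *
    (1 + (r * m%:R / a - 1)^-1 * (3 / 2) `^ (- (r * m%:R / a - 1))) ^+ n.
Proof.
move=> a0 m0 T0 amr; rewrite /head_count exchange_big /=.
have m0' : 0 < m%:R :> R by rewrite ltr0n.
have lr : 1 < m%:R / a * r.
  by rewrite mulrAC ltr_pdivlMr // mul1r -ltr_pdivrMl // mulrC.
have := sum_prod_powR_le R n N (m%:R / a) (fun=> r) (fun _ _ => lr).
rewrite prodr_const card_ord /= (_ : m%:R / a * r = r * m%:R / a); last by ring.
move=> zs; apply: le_trans (ler_wpM2l (powR_ge0 _ _) zs).
rewrite mulr_sumr; apply: ler_sum => s _.
set W := \prod_(j < n) _.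
have W0 : 0 < W by apply: prodr_gt0 => j _; rewrite powR_gt0 // nat1r ltr0n.
apply: le_trans (_ : _ <= (T / W) `^ (m%:R / a)) _.
  apply: le_trans (count_kmax_le R a m N (T / W) a0 _); last first.
    by rewrite divr_ge0 ?ltW.
  by apply: ler_sum => k _; rewrite ler_pdivlMr.
rewrite powRM ?(ltW T0) ?invr_ge0 ?(ltW W0) //.
by rewrite -[W^-1]powR_inv1 ?(ltW W0) // -powRrM mulN1r.
Qed.

Lemma head_count_eq (R : realType) (a r : R) (m n N : nat) (T : R) :
  0 < a -> (0 < m)%N -> 1 <= T -> r = a / m%:R ->
  head_count R a r m n N T <= T `^ (m%:R / a) *
    (2 ^+ n * (r^-1 * ln T + n%:R * ln 2) ^+ n / n`!%:R).
Proof.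
move=> a0 m0 T1 rE; rewrite /head_count exchange_big /=.
have m0' : 0 < m%:R :> R by rewrite ltr0n.
have T0 : 0 < T by lra.
have r0 : 0 < r by rewrite rE divr_gt0.
have rV : r^-1 = m%:R / a by rewrite rE invf_div.
have X1 : 1 <= T `^ r^-1 by rewrite powR_ge1 // invr_ge0 ltW.
rewrite -rV -(ln_powR T).
apply: le_trans (ler_wpM2l (powR_ge0 _ _) (sum_inv_vol_le R N n _ X1)).
rewrite mulr_sumr; apply: ler_sum => s _.
rewrite prod_powR_vol; set V := vol _ _ _.
have V0 : 0 < V by exact: vol_gt0.
have Vr0 : 0 < V `^ r by exact: powR_gt0.
rewrite -(powR_le_powRV R r V T) ?(ltW V0) ?(ltW T0) //.
case: (leP (V `^ r) T) => [VT|TV].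
  rewrite mulr1n mul1r.
  apply: le_trans (_ : _ <= (T / V `^ r) `^ (m%:R / a)) _.
    apply: le_trans (count_kmax_le R a m N (T / V `^ r) a0 _); last first.
      by rewrite divr_ge0 ?ltW.
    by apply: ler_sum => k _; rewrite ler_pdivlMr.
  rewrite -rV powRM ?(ltW T0) ?invr_ge0 ?(ltW Vr0) // -powRN -powRrM.
  by rewrite mulNr mulfV ?gt_eqF // powR_inv1 // ltW.
rewrite mul0r mulr0 big1 // => k _; rewrite leNgt (lt_le_trans TV) //.
by rewrite ler_peMl ?(ltW Vr0) // kmax_ge1.
Qed.

Lemma head_count_lt (R : realType) (a r : R) (m n N : nat) (T : R) :
  0 < a -> 0 < r -> (0 < m)%N -> 1 <= T -> r < a / m%:R ->
  head_count R a r m n.+1 N T <= T `^ r^-1 *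
    (2 ^+ n * (r^-1 * ln T + n%:R * ln 2) ^+ n / n`!%:R) *
    (m%:R * ((a / r - m%:R)^-1 * 2 `^ (a / r - m%:R))).
Proof.
move=> a0 r0 m0 T1 ram.
have m0' : 0 < m%:R :> R by rewrite ltr0n.
have T0 : 0 < T by lra.
have mar : m%:R < a / r by rewrite ltr_pdivlMr // mulrC -ltr_pdivlMr.
have ln2 : 0 <= ln 2 :> R by apply: ln_ge0; lra.
have nln2 : 0 <= n%:R * ln 2 :> R by exact: mulr_ge0.
have lT : 0 <= r^-1 * ln T by rewrite mulr_ge0 ?invr_ge0 ?ln_ge0 // ltW.
have c0 (z : R) : 0 <= z -> 0 <= 2 ^+ n * (z + n%:R * ln 2) ^+ n / n`!%:R.
  by move=> z0; rewrite divr_ge0 // mulr_ge0 ?exprn_ge0 // addr_ge0.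
have ks := sum_kmax_powRN_le R a r^-1 m N a0 m0 mar.
apply: le_trans (ler_wpM2l _ ks); last first.
  by rewrite mulr_ge0 ?powR_ge0 ?c0.
rewrite mulr_sumr; apply: ler_sum => k _; set K := kmax _ _ _ _.
have K1 : 1 <= K by exact: kmax_ge1.
have K0 : 0 < K by lra.
have TK0 : 0 < T / K by rewrite divr_gt0.
have -> : forall C, T `^ r^-1 * C * K `^ (- r^-1) = (T / K) `^ r^-1 * C.
  move=> C; rewrite mulrAC powRM ?(ltW T0) ?invr_ge0 ?(ltW K0) //.
  by rewrite -[K^-1]powR_inv1 ?(ltW K0) // -powRrM mulN1r.
have volE (s : {ffun 'I_n.+1 -> 'I_N}) :
    (K * \prod_(j < n.+1) (1 + (s j)%:R) `^ r <= T) =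
    (vol R n.+1 (fun j => s j) <= (T / K) `^ r^-1).
  rewrite prod_powR_vol mulrC -ler_pdivlMr // powR_le_powRV ?(ltW TK0) //.
  exact: ltW (vol_gt0 _ _ _).
under eq_bigr do rewrite volE.
have [Y1|Y1] := leP 1 ((T / K) `^ r^-1); last first.
  rewrite big1; first by apply: mulr_ge0; [exact: powR_ge0 | exact: c0].
  move=> s _.
  by rewrite leNgt (lt_le_trans Y1) // vol_ge1.
apply: le_trans (count_vol_le R N n _ Y1) _.
apply: ler_wpM2l; first exact: powR_ge0.
have lY : 0 <= ln ((T / K) `^ r^-1) by exact: ln_ge0.
have lYT : ln ((T / K) `^ r^-1) <= r^-1 * ln T.
  rewrite ln_powR ler_wpM2l ?invr_ge0 ?(ltW r0) // ler_ln ?posrE //.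
  by rewrite ler_pdivrMr // ler_peMr // ltW.
rewrite ler_wpM2r ?invr_ge0 // ler_wpM2l ?exprn_ge0 //.
by rewrite lerXn2r ?nnegrE ?addr_ge0 // lerD2r.
Qed.

(** The bound of the theorem is constC * T^lambda * [log_factor], in all three
    cases. *)
Definition log_factor (R : realType) (a r : R) (m t : nat) (T : R) : R :=
  if a / m%:R < r then 1
  else if r == a / m%:R then
    ln (2 * T `^ a^-1 + 1) * (r^-1 * ln T + t.+1%:R * ln 2) ^+ t
  else (r^-1 * ln T + t.+1%:R * ln 2) ^+ t.

Lemma log_factor_ge0 (R : realType) (a r : R) (m t : nat) (T : R) :
  0 < r -> 1 <= T -> 0 <= log_factor R a r m t T.
Proof.
move=> r0 T1; rewrite /log_factor; case: ifP => // _.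
have L0 : 0 <= r^-1 * ln T + t.+1%:R * ln 2.
  rewrite addr_ge0 // mulr_ge0 ?invr_ge0 ?ln_ge0 ?(ltW r0) //; lra.
case: ifP => _; last exact: exprn_ge0.
rewrite mulr_ge0 ?exprn_ge0 ?ln_ge0 // lerDr mulr_ge0 ?powR_ge0 //.
Qed.

Lemma lambda_gt (R : realType) (a r : R) (m : nat) : 0 < a -> (0 < m)%N ->
  0 < r -> a / m%:R < r -> lambda a r m = m%:R / a.
Proof.
move=> a0 m0 r0 amr; rewrite /lambda max_l // -[m%:R / a]invf_div.
by rewrite lef_pV2 ?posrE ?divr_gt0 ?ltr0n // ltW.
Qed.

Lemma lambda_le (R : realType) (a r : R) (m : nat) : 0 < a -> (0 < m)%N ->
  0 < r -> r <= a / m%:R -> lambda a r m = r^-1.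
Proof.
move=> a0 m0 r0 amr; rewrite /lambda max_r // -[m%:R / a]invf_div.
by rewrite lef_pV2 ?posrE ?divr_gt0 ?ltr0n.
Qed.

Lemma constB_ge0 (R : realType) (a r : R) (m t : nat) : 0 < a -> 0 < r ->
  (0 < m)%N -> 0 <= constB a r m t.
Proof.
move=> a0 r0 m0; have m0' : 0 < m%:R :> R by rewrite ltr0n.
rewrite /constB; case: ltP => [amr|ram].
  have q0 : 0 <= r * m%:R / a - 1.
    by rewrite subr_ge0 ler_pdivlMr // mul1r -ler_pdivrMr // ltW.
  rewrite mulr_ge0 ?exprn_ge0 // ?divr_ge0 // addr_ge0 // mulr_ge0 ?powR_ge0 //.
  by rewrite invr_ge0.
have b0 : 0 <= 2 ^+ t.+1 / t`!%:R :> R by rewrite divr_ge0 // exprn_ge0.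
case: ifP => _; first by rewrite mulr_ge0.
rewrite !mulr_ge0 ?powR_ge0 // invr_ge0 subr_ge0 ler_pdivlMr // mulrC.
by rewrite -ler_pdivlMr.
Qed.

(** The logarithmic factor is taken at an upper bound T of T', so that T' only
    enters through a pure power, which is what makes the sum over the tails
    factorize. *)
Lemma head_count_le (R : realType) (a r : R) (m t N : nat) (T' T : R) :
  0 < a -> 0 < r -> (0 < m)%N -> 1 <= T -> 0 < T' -> T' <= T ->
  head_count R a r m t.+1 N T' <=
  constB a r m t * (T' `^ lambda a r m * log_factor R a r m t T).
Proof.
move=> a0 r0 m0 T1 T'0 T'T.
have m0' : 0 < m%:R :> R by rewrite ltr0n.
have [T'1|T'1] := ltP T' 1.
  rewrite head_count_lt1 // mulr_ge0 ?constB_ge0 // mulr_ge0 ?powR_ge0 //.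
  exact: log_factor_ge0.
have T0 : 0 < T by lra.
have ln2 : 0 <= ln 2 :> R by apply: ln_ge0; lra.
have tln2 n : 0 <= n%:R * ln 2 :> R by exact: mulr_ge0.
have lT' : 0 <= r^-1 * ln T' by rewrite mulr_ge0 ?invr_ge0 ?ln_ge0 // ltW.
have lT'T : r^-1 * ln T' <= r^-1 * ln T.
  by rewrite ler_wpM2l ?invr_ge0 ?(ltW r0) // ler_ln ?posrE.
have [amr|] := ltP (a / m%:R) r.
  rewrite lambda_gt // /log_factor /constB amr mulr1 mulrC.
  apply: le_trans (head_count_gt R a r m t.+1 N T' a0 m0 T'0 amr) _.
  rewrite ler_wpM2l ?powR_ge0 // ler_peMl //.
    rewrite exprn_ge0 // addr_ge0 // mulr_ge0 ?powR_ge0 // invr_ge0.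
    by rewrite subr_ge0 ler_pdivlMr // mul1r -ler_pdivrMr // ltW.
  by rewrite exprn_ege1 // ler_pdivlMr // mul1r ler_nat.
rewrite le_eqVlt => /orP[/eqP rE|ram].
  have nl : (a / m%:R < r) = false by rewrite rE ltxx.
  have le : r <= a / m%:R by rewrite rE.
  rewrite lambda_le // /log_factor /constB nl -rE eqxx.
  have rV : r^-1 = m%:R / a by rewrite rE invf_div.
  apply: le_trans (head_count_eq R a r m t.+1 N T' a0 m0 T'1 rE) _.
  rewrite -rV [leRHS]mulrCA ler_wpM2l ?powR_ge0 //.
  set L' := r^-1 * ln T'; set L := r^-1 * ln T.
  have L0 : 0 <= L by exact: le_trans lT'T.
  apply: le_trans (_ : _ <=
    2 ^+ t.+1 * (L + t.+1%:R * ln 2) ^+ t.+1 / t.+1`!%:R) _.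
    rewrite ler_wpM2r ?invr_ge0 // ler_wpM2l ?exprn_ge0 //.
    by rewrite lerXn2r ?nnegrE ?addr_ge0 // lerD2r.
  (* One of the t + 1 logarithms is traded for the factor ln (2 T^(1/a) + 1):
     m ln (2 T^(1/a)) = L + m ln 2, since r = a/m. *)
  have lnm : L + ln 2 <= m%:R * ln (2 * T `^ a^-1 + 1).
    have P0 : 0 < T `^ a^-1 by exact: powR_gt0.
    apply: le_trans (_ : _ <= m%:R * ln (2 * T `^ a^-1)) _.
      rewrite lnM ?posrE // ln_powR mulrDr mulrA -rV addrC lerD2r.
      by rewrite ler_peMl // ler1n.
    rewrite ler_wpM2l ?ler0n // ler_ln ?posrE ?addr_gt0 ?mulr_gt0 //.
    by rewrite lerDl.
  have Ln : (L + t.+1%:R * ln 2) / t.+1%:R <= L + ln 2.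
    have t0 : 0 < t.+1%:R :> R by rewrite ltr0n.
    rewrite ler_pdivrMr // mulrDl [ln 2 * _]mulrC lerD2r ler_peMr // ler1n.
    by [].
  apply: le_trans (_ : _ <= 2 ^+ t.+1 / t`!%:R * (L + t.+1%:R * ln 2) ^+ t *
     (m%:R * ln (2 * T `^ a^-1 + 1))) _.
    apply: le_trans (ler_wpM2l _ (le_trans Ln lnm)).
      rewrite factS natrM invfM (exprSr (L + _)) le_eqVlt.
      apply/orP; left; apply/eqP.
      by ring.
    by rewrite mulr_ge0 ?exprn_ge0 ?divr_ge0 ?exprn_ge0 // addr_ge0.
  by rewrite le_eqVlt; apply/orP; left; apply/eqP; ring.
have nl : (a / m%:R < r) = false by rewrite ltNge ltW.
have ne : (r == a / m%:R) = false by rewrite lt_eqF.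
rewrite lambda_le ?(ltW ram) // /log_factor /constB nl ne.
apply: le_trans (head_count_lt R a r m t N T' a0 r0 m0 T'1 ram) _.
have q0 : 0 < a / r - m%:R.
  by rewrite subr_gt0 ltr_pdivlMr // mulrC -ltr_pdivlMr.
set L' := r^-1 * ln T'; set L := r^-1 * ln T; set q := a / r - m%:R.
pose c := T' `^ r^-1 * m%:R * q^-1 * 2 `^ q / t`!%:R.
apply: le_trans (_ : _ <= c * (2 ^+ t * (L' + t%:R * ln 2) ^+ t)) _.
  by rewrite le_eqVlt; apply/orP; left; apply/eqP; rewrite /c; ring.
apply: le_trans (_ : _ <= c * (2 ^+ t.+1 * (L + t.+1%:R * ln 2) ^+ t)) _.
  have c0 : 0 <= c by rewrite divr_ge0 // !mulr_ge0 ?powR_ge0 ?invr_ge0 ?ltW.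
  have LL : L' + t%:R * ln 2 <= L + t.+1%:R * ln 2.
    by apply: lerD => //; rewrite ler_wpM2r // ler_nat.
  apply: ler_wpM2l => //; apply: ler_pM; rewrite ?exprn_ge0 ?addr_ge0 //.
    by rewrite exprS ler_peMl ?exprn_ge0 // ler1n.
  rewrite lerXn2r ?nnegrE ?addr_ge0 //; exact: le_trans lT'T.
by rewrite le_eqVlt; apply/orP; left; apply/eqP; rewrite /c; ring.
Qed.

(** * Tails and finite parts of the cross *)

Lemma big_nat_shift (T : Type) (idx : T) (op : T -> T -> T) (n p : nat)
    (F : nat -> T) :
  \big[op/idx]_(n <= i < n + p) F i = \big[op/idx]_(j < p) F (n + j)%N.
Proof.
rewrite -{1}[n]add0n big_addn addKn big_mkord.
by apply: eq_bigr => j _; rewrite addnC.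
Qed.

(** Fixing the tail z first leaves a head count at T / P <= T, where P is the
    weight of z; the powers P^(-lambda) then sum to a product. *)
Lemma cross_count_le (R : realType) (a r : R) (m t p N : nat) (rho : nat -> R)
    (T : R) :
  0 < a -> 0 < r -> (0 < m)%N -> 1 <= T -> (forall j, 0 < rho j) ->
  (forall j, (j < p)%N -> 1 < lambda a r m * rho j) ->
  \sum_(z : {ffun 'I_p -> 'I_N}) \sum_(k : {ffun 'I_m -> 'I_N})
    \sum_(s : {ffun 'I_t.+1 -> 'I_N})
     (kmax R a m (fun j => k j) * \prod_(j < t.+1) (1 + (s j)%:R) `^ r *
      \prod_(j < p) (1 + (z j)%:R) `^ rho j <= T)%R%:R <=
  constB a r m t * (T `^ lambda a r m * log_factor R a r m t T) *
  \prod_(j < p) (1 + (lambda a r m * rho j - 1)^-1 *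
                     (3 / 2) `^ (- (lambda a r m * rho j - 1))).
Proof.
move=> a0 r0 m0 T1 rho0 rho1; have T0 : 0 < T by lra.
apply: le_trans (ler_wpM2l _ (sum_prod_powR_le R p N _ _ rho1)); last first.
  by rewrite mulr_ge0 ?constB_ge0 // mulr_ge0 ?powR_ge0 // log_factor_ge0.
rewrite mulr_sumr; apply: ler_sum => z _; set P := \prod_(j < p) _.
have P1 : 1 <= P.
  rewrite /P; elim/big_ind: _ => [|x y|j _] //; first exact: mulr_ege1.
  by rewrite powR_ge1 ?lerDl // ltW.
have P0 : 0 < P by lra.
have TP : T / P <= T by rewrite ler_pdivrMr // ler_peMr // ltW.
apply: le_trans (_ : _ <= head_count R a r m t.+1 N (T / P)) _.
  by apply: ler_sum => k _; apply: ler_sum => s _; rewrite ler_pdivlMr.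
apply: le_trans (head_count_le R a r m t N (T / P) T a0 r0 m0 T1 _ TP) _.
  exact: divr_gt0.
rewrite powRM ?(ltW T0) ?invr_ge0 ?(ltW P0) //.
rewrite -[P^-1]powR_inv1 ?(ltW P0) // -powRrM mulN1r.
by rewrite le_eqVlt; apply/orP; left; apply/eqP; ring.
Qed.

Lemma prod_1D_le_expR (R : realType) (p : nat) (u : nat -> R) :
  (forall j, 0 <= u j) ->
  \prod_(j < p) (1 + u j) <= expR (\sum_(j < p) u j).
Proof.
move=> u0; rewrite expR_sum; apply: ler_prod => j _.
by rewrite addr_ge0 // expR_ge1Dx.
Qed.

Lemma sum_le_constM (R : realType) (a r : R) (rs : nat -> R) (m t p : nat) :
  (constM a r rs m t < +oo)%E ->
  (forall j, (t < j)%N -> 1 < lambda a r m * rs j) ->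
  \sum_(j < p) (lambda a r m * rs (t.+1 + j)%N - 1)^-1 *
     (3 / 2) `^ (- (lambda a r m * rs (t.+1 + j)%N - 1)) <=
  fine (constM a r rs m t).
Proof.
move=> Moo lrs.
pose u (j : nat) : R := (lambda a r m * rs j - 1)^-1 *
     (3 / 2) `^ (- (lambda a r m * rs j - 1)).
have u0 j : (t < j)%N -> 0 <= u j.
  by move=> tj; rewrite mulr_ge0 ?powR_ge0 // invr_ge0 subr_ge0 ltW // lrs.
have M0 : (0 <= constM a r rs m t)%E.
  by apply: nneseries_ge0 => j tj _; rewrite lee_fin u0.
have Mfin : constM a r rs m t \is a fin_num by rewrite ge0_fin_numE.
rewrite -lee_fin fineK //.
have := @nneseries_lim_ge R (fun j => (u j)%:E) xpredT t.+1 (t.+1 + p)%N.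
move=> /(_ (fun j tj _ => u0 j tj)); apply: le_trans.
by rewrite sumEFin lee_fin big_nat_shift.
Qed.

(** Turns the infinite product of the weight into a finite one. *)
Lemma fsbig_tail (R : realType) (t N : nat) (F : nat -> R) :
  (forall j, (t.+1 + N <= j)%N -> F j = 1) ->
  \big[*%R/1]_(j \in [set j : nat | (t < j)%N]) F j =
  \prod_(j < N) F (t.+1 + j)%N.
Proof.
move=> F1; rewrite -(fsbig_widen [set` index_iota t.+1 (t.+1 + N)]).
- by rewrite -fsbig_seq ?iota_uniq // big_nat_shift.
- by move=> j /=; rewrite mem_index_iota => /andP[].
- move=> j [/= tj]; rewrite mem_index_iota tj /= => /negP.
  by rewrite -leqNgt => /F1.
Qed.

Lemma cross_weightE (R : realType) (a r : R) (rs : nat -> R) (m t N : nat)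
    (k : 'I_m -> nat) (s : nat -> nat) :
  (forall j, (N <= j)%N -> s j = 0%N) ->
  cross_weight a r rs t k s =
  kmax R a m k * \prod_(j < t.+1) (1 + (s j)%:R) `^ r *
  \prod_(j < N) (1 + (s (t.+1 + j)%N)%:R) `^ rs (t.+1 + j)%N.
Proof.
move=> s0; rewrite /cross_weight (fsbig_tail R t N) // => j Nj.
by rewrite s0 ?addr0 ?powR1 // (leq_trans _ Nj) // leq_addl.
Qed.

Definition index_bound (m : nat) (x : cross_index m) : nat :=
  maxn (\max_(j < m) x.1 j) (\max_(j <- finsupp x.2) maxn j (x.2 j)).

Lemma index_boundP (m : nat) (x : cross_index m) (N : nat) :
  (index_bound m x < N)%N ->
  [/\ forall j, (x.1 j < N)%N, forall j, (x.2 j < N)%N &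
      forall j, (N <= j)%N -> x.2 j = 0%N].
Proof.
rewrite gtn_max => /andP[kN sN].
have supp j : j \in finsupp x.2 -> (j < N)%N /\ (x.2 j < N)%N.
  move=> js; apply/andP; rewrite -gtn_max; apply: leq_ltn_trans sN.
  exact: (leq_bigmax_seq j).
split=> j; first by apply: leq_ltn_trans kN; exact: leq_bigmax.
  have [/supp[]//|/fsfun_dflt ->] := boolP (j \in finsupp x.2).
  by rewrite (leq_ltn_trans _ kN).
have [/supp[jN _]|/fsfun_dflt ->//] := boolP (j \in finsupp x.2).
by rewrite leqNgt jN.
Qed.

(** The indices of A inject into a finite box: the tail of the sequence is
    truncated after N coordinates, where N exceeds every support. *)
Lemma card_sub_cross_le (R : realType) (a r : R) (rs : nat -> R) (m t : nat)
    (T : R) (A : {fset cross_index m}) :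
  0 < a -> 0 < r -> (0 < m)%N -> 1 <= T -> (forall j, 0 < rs j) ->
  (forall j, (t < j)%N -> 1 < lambda a r m * rs j) ->
  (constM a r rs m t < +oo)%E ->
  [set` A] `<=` hyperbolic_cross a r rs m t T ->
  #|` A|%:R <= constC a r rs m t * (T `^ lambda a r m * log_factor R a r m t T).
Proof.
move=> a0 r0 m0 T1 rs0 lrs Moo AG.
pose N := (\max_(x : A) index_bound m (val x)).+1.
have bA (x : A) : (index_bound m (val x) < N)%N.
  by rewrite ltnS; exact: (leq_bigmax x).
pose X : finType := 
  ({ffun 'I_N -> 'I_N} * {ffun 'I_m -> 'I_N} * {ffun 'I_t.+1 -> 'I_N})%type.
pose w (y : X) : R := kmax R a m (fun j => y.1.2 j) *
  \prod_(j < t.+1) (1 + (y.2 j)%:R) `^ r *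
  \prod_(j < N) (1 + (y.1.1 j)%:R) `^ rs (t.+1 + j)%N.
pose f (x : A) : X := 
  ([ffun j : 'I_N => inord ((val x).2 (t.+1 + j)%N)],
   [ffun j : 'I_m => inord ((val x).1 j)],
   [ffun j : 'I_t.+1 => inord ((val x).2 j)]).
have wf (x : A) : w (f x) <= T.
  have [kN sN s0] := index_boundP m (val x) N (bA x).
  have := AG (val x) (valP x).
  rewrite /hyperbolic_cross /= (cross_weightE R a r rs m t N) //.
  apply: le_trans; rewrite /w /f /= le_eqVlt; apply/orP; left; apply/eqP.
  congr (_ * _ * _).
  - by apply: eq_bigr => j _; rewrite ffunE inordK.
  - by apply: eq_bigr => j _; rewrite ffunE inordK.
  - by apply: eq_bigr => j _; rewrite ffunE inordK.
have f_inj : injective f.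
  move=> x y fxy; apply: val_inj.
  have [kN sN s0] := index_boundP m (val x) N (bA x).
  have [kN' sN' s0'] := index_boundP m (val y) N (bA y).
  case: fxy => /ffunP e1 /ffunP e2 /ffunP e3.
  rewrite [LHS]surjective_pairing [RHS]surjective_pairing; congr (_, _).
    by apply/ffunP => j; have /(congr1 val) := e2 j; rewrite !ffunE /= !inordK.
  apply/fsfunP => j; have [jt|tj] := ltnP j t.+1.
    by have /(congr1 val) := e3 (Ordinal jt); rewrite !ffunE /= !inordK.
  have [jN|Nj] := ltnP (j - t.+1)%N N.
    have /(congr1 val) := e1 (Ordinal jN).
    by rewrite !ffunE /= !inordK // addnC subnK.
  by rewrite s0 ?s0' // (leq_trans Nj) // leq_subr.
have -> : #|` A| = #|[set f x | x : A]| by rewrite card_imset // cardfE.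
apply: (@le_trans _ _ (\sum_(y : X) (w y <= T)%R%:R)).
  rewrite -sum1_card natr_sum big_mkcond /=; apply: ler_sum => y _.
  by case: imsetP => [[x _ ->]|//]; rewrite wf.
have -> : \sum_(y : X) (w y <= T)%R%:R = \sum_(z : {ffun 'I_N -> 'I_N})
   \sum_(k : {ffun 'I_m -> 'I_N}) \sum_(s : {ffun 'I_t.+1 -> 'I_N})
      (w (z, k, s) <= T)%R%:R :> R.
  rewrite pair_big pair_big /=; apply: eq_bigr => -[[z k] s] _ //.
apply: le_trans (cross_count_le R a r m t N N (fun j => rs (t.+1 + j)%N) T
  a0 r0 m0 T1 (fun j => rs0 _) (fun j _ => lrs _ (leq_addr _ _))) _.
have u0 (j : nat) : 0 <= (lambda a r m * rs (t.+1 + j)%N - 1)^-1 *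
     (3 / 2) `^ (- (lambda a r m * rs (t.+1 + j)%N - 1)).
  by rewrite mulr_ge0 ?powR_ge0 // invr_ge0 subr_ge0 ltW // lrs // leq_addr.
rewrite mulrC /constC -mulrA ler_wpM2r //.
  by rewrite mulr_ge0 ?constB_ge0 // mulr_ge0 ?powR_ge0 // log_factor_ge0.
apply: le_trans (prod_1D_le_expR R N _ u0) _.
by rewrite ler_expR; exact: sum_le_constM.
Qed.

Theorem theorem2p6 (R : realType) (m : nat) (a : R) (t : nat) (r : R)
    (rs : nat -> R)
    (hm : (0 < m)%N) (ha : 0 < a) (hr : 0 < r)
    (rs_pos : forall j : nat, 0 < rs j)
    (rs_head : forall j : nat, (j < t.+1)%N -> rs j = r)
    (rs_tail : forall j : nat, (t < j)%N -> rs j <= rs j.+1)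
    (hlambda : 1 < lambda a r m * rs t.+1)
    (hM : (constM a r rs m t < +oo)%E)
    (T : R) (hT : 1 <= T) :
  finite_set (hyperbolic_cross a r rs m t T) /\
  (#|` fset_set (hyperbolic_cross a r rs m t T) |)%:R
  <= constC a r rs m t
     * (if a / m%:R < r then T `^ (m%:R / a)
        else if r == a / m%:R then
          T `^ (m%:R / a) * ln (2 * T `^ a^-1 + 1)
          * (r^-1 * ln T + t.+1%:R * ln 2) ^+ t
        else
          T `^ r^-1 * (r^-1 * ln T + t.+1%:R * ln 2) ^+ t).
Proof.
have lrs j : (t < j)%N -> 1 < lambda a r m * rs j.
  elim: j => // j IH; rewrite ltnS leq_eqVlt => /orP[/eqP <- //|tj].
  apply: lt_le_trans (IH tj) _; apply: ler_wpM2l; last exact: rs_tail.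
  by rewrite /lambda le_max invr_ge0 (ltW hr) orbT.
have cardA A := card_sub_cross_le R a r rs m t T A ha hr hm hT rs_pos lrs hM.
have Gfin : finite_set (hyperbolic_cross a r rs m t T).
  apply: contrapT => /infinite_set_fset.
  set b := constC a r rs m t * (T `^ lambda a r m * log_factor R a r m t T)
    in cardA.
  move=> /(_ (Num.trunc b).+1)[A AG cA].
  have := cardA A AG; rewrite leNgt => /negP; apply.
  apply: lt_le_trans (truncnS_gt b) _; rewrite ler_nat.
  exact: cA.
split=> //.
have := cardA (fset_set (hyperbolic_cross a r rs m t T)).
rewrite fset_setK // => /(_ (fun x h => h)) /le_trans; apply.
rewrite le_eqVlt; apply/orP; left; apply/eqP; congr (_ * _).
rewrite /log_factor; case: ltP => [amr|ram].
  by rewrite lambda_gt // mulr1.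
rewrite lambda_le //; case: eqP => [rE|//].
by rewrite mulrA (_ : r^-1 = m%:R / a) // rE invf_div.
Qed.
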